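(* Let $Z$ be a measurable space (the full trial alphabet), let $\mathcal C$ be any class of probability distributions on $Z$, let $W$ be a finite set, and let $\pi:Z\to W$ be a measurable map. Then for every probability distribution $P$ on $Z$, $$\inf_{Q\in\mathcal C} D_{\mathrm{KL}}(P\Vert Q)\;\ge\;\inf_{R\in\pi_\#\mathcal C} D_{\mathrm{KL}}(\pi_\# P\Vert R).$$
   Context: $D_{\mathrm{KL}}(P\Vert Q)$ is the Kullback--Leibler divergence, with values in $[0,\infty]$ (equal to $+\infty$ when $P$ is not absolutely continuous with respect to $Q$), taken with a fixed logarithm base. $W$ carries the discrete $\sigma$-algebra. $\pi_\# P$ denotes the push-forward of $P$ under $\pi$, i.e. $(\pi_\# P)(B)=P(\pi^{-1}(B))$, and $\pi_\#\mathcal C:=\{\pi_\# Q: Q\in\mathcal C\}$. *)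

(* Defs.v *)
From HB Require Import structures.
From mathcomp Require Import all_boot all_order all_algebra.
From mathcomp Require Import all_classical all_reals all_analysis.

Set Implicit Arguments.
Unset Strict Implicit.
Unset Printing Implicit Defensive.

Import Order.TTheory GRing.Theory Num.Theory.
Import numFieldNormedType.Exports.

Local Open Scope classical_set_scope.
Local Open Scope ring_scope.
Local Open Scope ereal_scope.
Local Open Scope charge_scope.

(* [lne 0 = -oo]; for [1 < b] this is the base-[b] logarithm. *)
Definition logbe (R : realType) (b : R) (x : \bar R) : \bar R :=
  lne x * ((ln b)^-1)%:E.

(* The negative part of the integrand is always [P]-integrable, so the integral
   never has the form [+oo - oo]. The Radon-Nikodym derivative is only
   determined, and only guaranteed to be positive, [P]-almost everywhere, which
   does not affect the integral against [P]. *)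
Definition kl_div (R : realType) (b : R) (d : measure_display)
    (T : measurableType d) (P Q : probability T R) : \bar R :=
  if pselect (P `<< Q) then
    \int[P]_x logbe b (('d (charge_of_finite_measure P) '/d Q) x)
  else +oo.

Definition pushforward_class (R : realType) (d d' : measure_display)
    (Z : measurableType d) (W : measurableType d') (pi : {mfun Z >-> W})
    (C : set (probability Z R)) : set (probability W R) :=
  [set (distribution Q pi : probability W R) | Q in C].

(* Main.v *)
(* It is enough to prove the data processing inequality for each [Q], and only
   when [P << Q]. Let [f] be the density of [P] with respect to [Q], and [g]
   that of the push-forward of [P] with respect to that of [Q]. [P]-almost
   everywhere [f] and [g o pi] are positive, and the tangent inequality gives
   [ln f >= ln (g o pi) + (1 - (g o pi) / f)]. The integral of the last summand
   is nonnegative, since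
   [int (g o pi) / f dP <= int (g o pi) dQ = int g d(pi_# Q) = 1].
   Finiteness of [W] makes [ln (g o pi)] bounded, hence integrable. *)
Require Import Defs.
From HB Require Import structures.
From mathcomp Require Import all_boot all_order all_algebra.
From mathcomp Require Import all_classical all_reals all_analysis.
From mathcomp Require Import measurable_realfun lra.

Set Implicit Arguments.
Unset Strict Implicit.
Unset Printing Implicit Defensive.

Import Order.TTheory GRing.Theory Num.Theory.
Import numFieldNormedType.Exports.

Local Open Scope classical_set_scope.
Local Open Scope ring_scope.
Local Open Scope ereal_scope.

Local Open Scope charge_scope.

Section integral_and_logarithm.
Context d (T : measurableType d) (R : realType).

(* No integrability is needed: subtraction on [\bar R] is monotone even at
   [+oo - oo]. *)
Lemma ae_le_integral (mu : {measure set T -> \bar R}) (D : set T)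
    (f g : T -> \bar R) :
  measurable D -> measurable_fun D f -> measurable_fun D g ->
  {ae mu, forall x, D x -> f x <= g x} ->
  \int[mu]_(x in D) f x <= \int[mu]_(x in D) g x.
Proof.
move=> mD mf mg fg; rewrite integralE [leRHS]integralE leeB//.
  apply: ae_ge0_le_integral => //; [exact: measurable_funepos..|].
  move: fg; apply: filterS => x /[apply] fgx.
  (* The monotonicity of positive parts is stated on a set; the singleton of [x] yields the
     pointwise version. *)
  by apply: (@funepos_le _ _ [set x] f g) => // [y|]; rewrite inE// => ->.
apply: ae_ge0_le_integral => //; [exact: measurable_funeneg..|].
move: fg; apply: filterS => x /[apply] fgx.
by apply: (@funeneg_le _ _ [set x] f g) => // [y|]; rewrite inE// => ->.
Qed.

Lemma measurable_lne : measurable_fun setT (@lne R).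
Proof.
(* Splitting by order comparisons isolates the two infinite values, leaving the measurability of the
   real logarithm after [fine]. *)
have -> : @lne R = fun x => if x <= 0 then -oo else
    if +oo <= x then +oo else (ln (fine x))%:E.
  by apply/funext => -[r| |] /=; rewrite ?lee_fin ?leNye.
apply: measurable_fun_ifT => //; first exact: measurable_fun_lee.
apply: measurable_fun_ifT => //; first exact: measurable_fun_lee.
apply/measurable_EFinP; apply: measurableT_comp; first exact: measurable_ln.
exact: fine_measurable.
Qed.

Lemma measurable_logbe (b : R) : measurable_fun setT (logbe b).
Proof. by apply: emeasurable_funM => //; exact: measurable_lne. Qed.

End integral_and_logarithm.

Section radon_nikodym.
Context d (T : measurableType d) (R : realType) (P Q : probability T R).
Hypothesis PQ : P `<< Q.

Local Notation f := (Radon_Nikodym_SigmaFinite.f P Q).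

Lemma measurable_RN : measurable_fun setT f.
Proof. exact: measurable_int (Radon_Nikodym_SigmaFinite.f_integrable PQ). Qed.

(** The zero set of [f] has [P]-mass equal to the [Q]-integral of [f] over it, which is 0. *)
Lemma ae_RN_gt0 : {ae P, forall x, 0 < f x}.
Proof.
exists (f @^-1` [set 0]); split.
- by rewrite -[X in measurable X]setTI; exact: measurable_RN.
- rewrite (Radon_Nikodym_SigmaFinite.f_integral PQ)//; last first.
    by rewrite -[X in measurable X]setTI; exact: measurable_RN.
  by rewrite (eq_integral (cst 0)) ?integral0// => x; rewrite inE.
- move=> x /= /negP; rewrite -leNgt => fx0; apply/eqP.
  by rewrite eq_le fx0 Radon_Nikodym_SigmaFinite.f_ge0.
Qed.

(** Passes to a version of the density that is nonnegative and finite everywhere. The two versions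
    agree [Q]-almost everywhere, hence [P]-almost everywhere by domination. *)
Lemma kl_divE (b : R) : kl_div b P Q = \int[P]_x logbe b (f x).
Proof.
rewrite /kl_div; case: pselect => // ?; apply: ae_eq_integral => //.
- by apply: measurableT_comp; [exact: measurable_logbe|].
- by apply: measurableT_comp; [exact: measurable_logbe|exact: measurable_RN].
- have := null_dominates_ae_eq measurableT PQ
    (ae_eq_Radon_Nikodym_SigmaFinite PQ measurableT).
  by apply: filterS => x /= + _ => -> .
Qed.

End radon_nikodym.

Lemma logbe_EFin (R : realType) (b r : R) :
  (0 < r)%R -> logbe b r%:E = (ln r / ln b)%:E.
Proof. by move=> r0; rewrite /logbe lne_EFin. Qed.

(** The tangent bound [ln (1 + t) <= t] at [t = y / x - 1]. *)
Lemma ln_ge_ratio (R : realType) (x y : R) : (0 < x)%R -> (0 < y)%R ->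
  (ln y + (1 - y / x) <= ln x)%R.
Proof.
move=> x0 y0; have yx0 : (0 < y / x)%R by rewrite divr_gt0.
have : (ln (1 + (y / x - 1)) <= y / x - 1)%R.
  by apply: le_ln1Dx; rewrite ltrBrDr addrC subrr.
rewrite addrC subrK lnM ?posrE ?invr_gt0// lnV ?posrE//; lra.
Qed.

Lemma kl_div_distribution_le (R : realType) (b : R) (dZ : measure_display)
    (Z : measurableType dZ) (dW : measure_display) (W : measurableType dW)
    (pi : {mfun Z >-> W}) (P Q : probability Z R) :
  (1 < b)%R -> finite_set [set: W] ->
  kl_div b (distribution P pi) (distribution Q pi) <= kl_div b P Q.
Proof.
move=> b1 finW.
have [PQ|nPQ] := EM (P `<< Q); last first.
  by rewrite [leRHS]/kl_div; case: pselect => //= _; rewrite leey.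
have mpi : measurable_fun setT pi by exact: measurable_funP.
have piPQ : distribution P pi `<< distribution Q pi.
  apply/null_content_dominatesP => A mA.
  move/null_content_dominatesP : PQ; apply.
  by rewrite -[X in measurable X]setTI; exact: mpi.
rewrite !kl_divE//.
set f := Radon_Nikodym_SigmaFinite.f P Q.
set g := Radon_Nikodym_SigmaFinite.f (distribution P pi) (distribution Q pi).
have mf : measurable_fun setT f by exact: measurable_RN.
have mg : measurable_fun setT g by exact: measurable_RN.
have f0 x : 0 <= f x by exact: Radon_Nikodym_SigmaFinite.f_ge0.
have g0 x : 0 <= g x by exact: Radon_Nikodym_SigmaFinite.f_ge0.
have ffin x : f x \is a fin_num by exact: Radon_Nikodym_SigmaFinite.f_fin_num.
have gfin x : g x \is a fin_num by exact: Radon_Nikodym_SigmaFinite.f_fin_num.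
pose u z : R := fine (f z).
pose v w : R := fine (g w).
have mmu : measurable_fun setT u by apply: measurableT_comp.
have mv : measurable_fun setT v by apply: measurableT_comp.
have u0 z : (0 <= u z)%R by rewrite fine_ge0.
have v0 w : (0 <= v w)%R by rewrite fine_ge0.
pose ratio z : R := (v (pi z) / u z)%R.
have mratio : measurable_fun setT ratio.
  apply: measurable_funM; first exact: measurableT_comp.
  (* Measurability of the inverse comes from that of real powers; both conventions give 0 at 0. *)
  rewrite (_ : (fun z => _) = (fun z => u z `^ (-1))%R); last first.
    by apply/funext => z; rewrite powR_inv1.
  by apply: (measurableT_comp (measurable_powR (-1)%R)).
have ratio0 z : (0 <= ratio z)%R by rewrite divr_ge0.
(* Only [<=]: [ratio] has the junk value [0] where [u] vanishes. *)
have ratio1 : \int[P]_z (ratio z)%:E <= 1.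
  rewrite -(Radon_Nikodym_SigmaFinite.change_of_variables PQ)//=; last first.
    exact/measurable_EFinP.
  apply: (@le_trans _ _ (\int[Q]_z (g \o pi) z)).
    apply: ge0_le_integral => //.
    - by move=> z _; rewrite mule_ge0 ?lee_fin.
    - by apply: emeasurable_funM => //; exact/measurable_EFinP.
    - exact: measurableT_comp.
    - move=> z _ /=; rewrite -[g (pi z)]fineK// -/f -[f z]fineK//.
      rewrite -EFinM lee_fin -/(u z) /ratio.
      have [->|uz0] := eqVneq (u z) 0%R; first by rewrite mulr0 v0.
      by rewrite divfK.
  rewrite -(preimage_setT pi) -ge0_integral_pushforward//.
  rewrite -(@Radon_Nikodym_SigmaFinite.f_integral _ _ _ (distribution P pi)
    (distribution Q pi))//.
  exact: probability_le1.
have iratio : P.-integrable setT (EFin \o ratio).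
  apply/integrableP; split; first exact/measurable_EFinP.
  under eq_integral do rewrite gee0_abs ?lee_fin//.
  exact: le_lt_trans ratio1 (ltry _).
have lnb0 : (0 < (ln b)^-1)%R by rewrite invr_gt0 ln_gt0.
(* The real logarithm sends 0 to 0, so [k] is finite everywhere, whereas [logbe b (g w)] is [-oo]
   where [g] vanishes. The two agree almost everywhere for the push-forward of [P]. *)
pose k w : R := (ln (v w) / ln b)%R.
have mk : measurable_fun setT k.
  apply: measurable_funM => //; apply: measurableT_comp => //.
have ik : P.-integrable setT (EFin \o (k \o pi)).
  apply: measurable_bounded_integrable => //.
  - by apply: le_lt_trans (probability_le1 P measurableT) _; rewrite ltry.
  - exact: measurableT_comp.
  - have /finite_compact/compact_bounded[M [Mreal Mk]] : finite_set (range k).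
      exact: finite_image.
    by exists M; split => // x Mx z _; apply: (Mk _ Mx); exists (pi z).
have -> : \int[distribution P pi]_w logbe b (g w) = \int[P]_z (k (pi z))%:E.
  transitivity (\int[distribution P pi]_w (k w)%:E).
    apply: ae_eq_integral => //.
    - by apply: measurableT_comp => //; exact: measurable_logbe.
    - exact/measurable_EFinP.
    - have := ae_RN_gt0 piPQ; apply: filterS => w /= gw _.
      by rewrite -[g w]fineK// logbe_EFin ?fine_gt0// gw/= ltey_eq gfin.
  rewrite (@integral_pushforward _ _ _ _ _ _ mpi P setT (EFin \o k))//.
  exact/measurable_EFinP.
have imass : P.-integrable setT (EFin \o (fun z => 1 - ratio z)%R).
  rewrite (_ : EFin \o _ = (fun z => 1 - (ratio z)%:E))//.
  by apply: integrableB => //; exact: finite_measure_integrable_cst.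
(* The middle term integrates the tangent lower bound, scaled to base [b]. Its correction has
   nonnegative integral by [ratio1]; it then remains to compare integrands almost everywhere. *)
apply: (@le_trans _ _
  (\int[P]_z ((k (pi z))%:E + ((ln b)^-1%:E * (1 - ratio z)%:E)))).
  rewrite integralD//; last exact: integrableZl.
  rewrite leeDl// integralZl// mule_ge0 ?lee_fin ?(ltW lnb0)//.
  rewrite (eq_integral (fun z => cst 1 z - (ratio z)%:E))//.
  rewrite integralB//; last exact: finite_measure_integrable_cst.
  have -> : \int[P]_z cst 1 z = 1.
    by rewrite integral_cst// mul1e; exact: probability_setT.
  by rewrite suber_ge0 ?integrable_fin_num.
apply: ae_le_integral => //.
- apply: emeasurable_funD; first exact: (measurable_int P).
  by apply: emeasurable_funM => //; exact: (measurable_int P).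
- by apply: measurableT_comp => //; exact: measurable_logbe.
- have gpi : {ae P, forall z, 0 < g (pi z)}.
    have [N [mN N0 gN]] := ae_RN_gt0 piPQ.
    (* The [P]-mass of this preimage is by definition the push-forward mass of the null set [N]. *)
    exists (pi @^-1` N); split => //; last by move=> z; exact: gN.
    by rewrite -[X in measurable X]setTI; exact: mpi.
  have := ae_RN_gt0 PQ; apply: filterS2 gpi => z gz fz _.
  have uz : (0 < u z)%R by rewrite fine_gt0// fz/= ltey_eq ffin.
  have vz : (0 < v (pi z))%R by rewrite fine_gt0// gz/= ltey_eq gfin.
  rewrite -[f z]fineK// logbe_EFin// -EFinM -EFinD lee_fin.
  rewrite [X in (_ + X)%R]mulrC -mulrDl ler_wpM2r ?(ltW lnb0)//.
  exact: ln_ge_ratio.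
Qed.

Theorem theorem2 (R : realType) (b : R) (hb : (1 < b)%R)
    (dZ : measure_display) (Z : measurableType dZ)
    (C : set (probability Z R))
    (dW : measure_display) (W : measurableType dW)
    (finW : finite_set [set: W])
    (discrW : forall B : set W, measurable B)
    (pi : {mfun Z >-> W}) (P : probability Z R) :
  ereal_inf [set kl_div b P Q | Q in C] >=
  ereal_inf [set kl_div b (distribution P pi) S | S in pushforward_class pi C].
Proof.
apply: le_ereal_inf_tmp => _ [Q CQ <-].
(* Each [Q] is matched with its own push-forward. *)
apply: ge_ereal_inf; exists (kl_div b (distribution P pi) (distribution Q pi)).
  by exists (distribution Q pi) => //; exists Q.
exact: kl_div_distribution_le.
Qed.
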